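(* Every finite connected arc-transitive circulant is a CI-circulant. That is, if $G$ is a finite cyclic group and $S$ is a nonempty subset of $G$ such that $\mathrm{Cay}(G,S)$ is connected and arc-transitive, then for every subset $T\subseteq G$ with $\mathrm{Cay}(G,S)\cong\mathrm{Cay}(G,T)$ there exists $\alpha\in\mathrm{Aut}(G)$ with $T=S^\alpha$.
   Context: A digraph is a pair $(V,A)$ with $A\subseteq V\times V$; it is connected if its underlying undirected graph is connected, and arc-transitive if its automorphism group is transitive on $A$. For a group $G$ and nonempty $S\subseteq G$, the Cayley digraph $\mathrm{Cay}(G,S)$ has vertex set $G$, with $x$ pointing to $y$ iff $yx^{-1}\in S$. A Cayley digraph $\mathrm{Cay}(G,S)$ of a cyclic group $G$ is a CI-circulant if for each $T\subseteq G$ with $\mathrm{Cay}(G,S)\cong\mathrm{Cay}(G,T)$ there is $\alpha\in\mathrm{Aut}(G)$ with $T=S^\alpha$. A circulant is a digraph isomorphic to a Cayley digraph of a finite cyclic group. *)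

(* Defs.v *)
From mathcomp Require Import all_boot all_order all_fingroup all_solvable.
Set Implicit Arguments. Unset Strict Implicit. Unset Printing Implicit Defensive.
Local Open Scope group_scope.

Definition cay_arc (gT : finGroupType) (S : {set gT}) : rel gT :=
  fun x y => (y * x^-1) \in S.

Definition digraph_connected (T : finType) (e : rel T) : Prop :=
  forall x y : T, connect (fun a b => e a b || e b a) x y.

Definition digraph_aut (T : finType) (e : rel T) (f : {perm T}) : Prop :=
  forall u v : T, e (f u) (f v) = e u v.

Definition arc_transitive (T : finType) (e : rel T) : Prop :=
  forall x y x' y' : T, e x y -> e x' y' ->
    exists f : {perm T}, [/\ digraph_aut e f, f x = x' & f y = y'].

Definition digraph_iso (T : finType) (e1 e2 : rel T) : Prop :=
  exists f : {perm T}, forall u v : T, e2 (f u) (f v) = e1 u v.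

(* Main.v *)
Require Import Defs.
From mathcomp Require Import all_boot all_order all_fingroup all_solvable.
From mathcomp Require Import ssralg zmodp matrix.
Set Implicit Arguments. Unset Strict Implicit. Unset Printing Implicit Defensive.
Local Open Scope group_scope.

(* Let A be the automorphism group of Cay(G, S); arc-transitivity makes S an orbit of the
   stabiliser of 1, so every isomorphism f : Cay(G, S) -> Cay(G, T) fixing 1 acts on the
   Schur ring of A.  Reducing the p-th power of the adjacency matrix modulo p shows that,
   on sets of this ring, f commutes with x |-> x^k for k prime to |G|.  Since the units k with u^k in S form the
   stabiliser of S, whenever u is a generator in S, it is enough to connect every point s
   of S to a generator, inside S and inside the corresponding orbit of the automorphism
   group of Cay(G, T) simultaneously.

   This is done one prime p at a time: if the p-part of s is not a generator of the Sylow
   subgroup G_p, then S contains every y in s G_p whose p-part is.  Let R be the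
   stabiliser of S under translation.  If p^2 divides |G / R|, let H be the largest stable
   subgroup whose p-part is that of R, and V the smallest stable subgroup containing R and
   the subgroup P of order p |R_p|.  One finds G = V H, every orbit outside H is invariant
   under P away from P H, and (as in the Burnside-Schur theorem) counting the pairs that
   leave an orbit under translation by V \ H shows that each orbit fills more than half
   of every coset of V that it meets outside H.  Two such orbits in one coset coincide,
   so S contains s V \ H for every s in S. *)

(** * Isomorphisms of Cayley digraphs and power maps *)

(** Isomorphisms of Cayley digraphs, with [X] and [Y] as the connection sets. *)
Definition carries (gT : finGroupType) (f : {perm gT}) (X Y : {set gT}) :=
  forall u v, (f v * (f u)^-1 \in Y) = (v * u^-1 \in X).

Section Adjacency.
Import GRing.Theory.
Local Open Scope ring_scope.
Variables (gT : finGroupType) (p : nat).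
Hypotheses (abG : abelian [set: gT]) (p_pr : prime p).

Let mulC (x y : gT) : (x * y = y * x)%g.
Proof. by apply: (centsP abG); rewrite inE. Qed.

(** The matrix size is written as a successor so that square matrices form a nontrivial ring. *)
Let card_predK : #|gT|.-1.+1 = #|gT|.
Proof. by rewrite prednK //; apply/card_gt0P; exists 1%g. Qed.

Let vert (i : 'I_#|gT|.-1.+1) : gT := enum_val (cast_ord card_predK i).
Let idx (x : gT) : 'I_#|gT|.-1.+1 := cast_ord (esym card_predK) (enum_rank x).

Let vertK : cancel vert idx.
Proof. by move=> i; rewrite /vert /idx enum_valK cast_ordK. Qed.
Let idxK : cancel idx vert.
Proof. by move=> x; rewrite /vert /idx cast_ordKV enum_rankK. Qed.

Let adj (X : {set gT}) : 'M['F_p]_#|gT|.-1.+1 :=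
  \matrix_(i, j) (vert j * (vert i)^-1 \in X)%g%:R.

Let adj1M x y : adj [set x] * adj [set y] = adj [set (x * y)%g].
Proof.
apply/matrixP=> i j; rewrite !mxE (bigD1 (idx (x * vert i)%g)) //= !mxE !idxK.
rewrite mulgK !inE eqxx mul1r big1 ?addr0 => [|k ne_k].
  by congr (_%:R); rewrite !(can2_eq (mulgKV _) (mulgK _)) mulgA (mulC y).
rewrite !mxE inE (can2_eq (mulgKV _) (mulgK _)).
case: eqP => [Dk|_]; last by rewrite mul0r.
by rewrite -Dk vertK eqxx in ne_k.
Qed.

Let adj1X x k : adj [set x] ^+ k = adj [set (x ^+ k)%g].
Proof.
elim: k => [|k IHk]; last by rewrite exprS IHk adj1M expgS.
apply/matrixP=> i j; rewrite !mxE inE -eq_mulgV1.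
by rewrite (inj_eq (can_inj vertK)) eq_sym.
Qed.

Let adj_sum X : adj X = \sum_(x in X) adj [set x].
Proof.
apply/matrixP=> i j; rewrite summxE mxE.
under eq_bigr => x _ do rewrite mxE inE.
case: (boolP (_ \in X)) => [Xz | notXz].
  rewrite (bigD1 _ Xz) /= eqxx big1 ?addr0 // => x /andP[_ ne_x].
  by rewrite eq_sym (negPf ne_x).
by rewrite big1 // => x Xx; case: eqP => // Dx; rewrite Dx Xx in notXz.
Qed.

(** The matrices [adj [set x]] commute and multiply like the elements of G, so in characteristic p
    the p-th power of their sum is the sum of their p-th powers. *)
Let adj_exp X : adj X ^+ p =
  \matrix_(i, j) #|[set x in X | (x ^+ p == vert j * (vert i)^-1)%g]|%:R.
Proof.
have charM : p \in [pchar 'M['F_p]_#|gT|.-1.+1].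
  rewrite inE p_pr /=; apply/eqP/matrixP=> i j.
  rewrite -scaler_nat !mxE -[p%:R]/(p%:R : 'F_p).
  by rewrite pchar_Fp_0 // mul0r.
have FrobE : pFrobenius_aut charM (adj X) = \sum_(x in X) adj [set (x ^+ p)%g].
  (* Frobenius is additive on commuting matrices only, so the induction also records that partial
     sums commute with every [adj [set y]]. *)
  rewrite adj_sum; pose K B := forall y, GRing.comm (adj [set y]) B.
  suff: K (\sum_(x in X) adj [set x]) /\
    pFrobenius_aut charM (\sum_(x in X) adj [set x]) =
    \sum_(x in X) adj [set (x ^+ p)%g] by case.
  elim/big_rec2: _ => [|x B2 B1 Xx [KB IH]].
    by split; [move=> y; apply: commr0 | apply: pFrobenius_aut0].
  split; first by move=> y; apply: commrD => //; rewrite /GRing.comm !adj1M mulC.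
  by rewrite pFrobenius_autD_comm // IH pFrobenius_autE adj1X.
rewrite -pFrobenius_autE FrobE; apply/matrixP=> i j; rewrite summxE mxE.
under eq_bigr => x _ do rewrite mxE inE eq_sym.
rewrite -sumr_const big_mkcond [RHS]big_mkcond /=; apply: eq_bigr => x _.
by rewrite inE; case: (x \in X) => //=; case: (_ == _).
Qed.

(** Relabelling vertices by [f] turns [adj X] into [adj Y], hence also their p-th powers, whose
    entries are these counts modulo p. *)
Lemma carries_power_count (f : {perm gT}) (X Y : {set gT}) (u v : gT) :
  carries f X Y ->
  #|[set x in X | x ^+ p == v * u^-1]%g| =
  #|[set y in Y | y ^+ p == f v * (f u)^-1]%g| %[mod p].
Proof.
move=> fXY; pose s i := idx (f (vert i)).
have s_bij : bijective s.
  by exists (fun i => idx (f^-1%g (vert i))) => i; rewrite /s idxK ?permK ?permKV vertK.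
have expE k i j : (adj Y ^+ k) (s i) (s j) = (adj X ^+ k) i j.
  elim: k i j => [|k IHk] i j.
    by rewrite !expr0 !mxE (inj_eq (bij_inj s_bij)).
  rewrite !exprS !mxE (reindex s) /=; last exact: onW_bij.
  by apply: eq_bigr => l _; rewrite IHk !mxE !idxK fXY.
have := expE p (idx u) (idx v); rewrite !adj_exp !mxE !idxK => /(congr1 (@nat_of_ord _)).
by rewrite !val_Fp_nat.
Qed.
End Adjacency.

Section Carries.
Variable gT : finGroupType.
Hypothesis cycG : cyclic [set: gT].
Implicit Types (f : {perm gT}) (X Y : {set gT}) (H J K R W : {group gT}).

Let abG : abelian [set: gT] := cyclic_abelian cycG.

Lemma cyclic_mulC (x y : gT) : x * y = y * x.
Proof. by apply: (centsP abG); rewrite inE. Qed.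
Local Notation mulC := cyclic_mulC.

Lemma expgMC (x y : gT) k : (x * y) ^+ k = x ^+ k * y ^+ k.
Proof. by rewrite expgMn //; apply: mulC. Qed.

Lemma carriesV f X Y : carries f X Y -> carries f^-1 Y X.
Proof. by move=> fXY u v; rewrite -fXY !permKV. Qed.

Lemma carries_eq f X Y : f 1 = 1 -> carries f X Y -> Y = f @: X.
Proof.
move=> f1 fXY; apply/setP=> y; rewrite -[y](permKV f) mem_imset; last exact: perm_inj.
by have := fXY 1 (f^-1 y); rewrite f1 !invg1 !mulg1.
Qed.

Lemma carries_gen f X Y : carries f X Y -> carries f <<X>> <<Y>>.
Proof.
have half g X' Y' u v : carries g X' Y' ->
    v * u^-1 \in <<X'>> -> g v * (g u)^-1 \in <<Y'>>.
  (* The multipliers [k] that keep every image in its coset of [<<Y'>>] form a subgroup, and it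
     contains [X']. *)
  move=> gXY; pose K := [set k | [forall w, g (k * w) * (g w)^-1 \in <<Y'>>]].
  have gK : group_set K.
    apply/group_setP; split=> [|k1 k2].
      by rewrite inE; apply/forallP=> w; rewrite mul1g mulgV group1.
    rewrite !inE => /forallP K1 /forallP K2; apply/forallP=> w.
    by have := groupM (K1 (k2 * w)) (K2 w); rewrite !mulgA mulgKV.
  have sXK : <<X'>> \subset group gK.
    rewrite gen_subG; apply/subsetP=> x Xx; rewrite inE; apply/forallP=> w.
    by apply: mem_gen; rewrite gXY mulgK.
  by move/(subsetP sXK); rewrite inE => /forallP/(_ u); rewrite mulgKV.
move=> fXY u v; apply/idP/idP; last exact: half.
by move/(half _ _ _ _ _ (carriesV fXY)); rewrite !permK.
Qed.

Lemma carries_group f H K : f 1 = 1 -> carries f H K -> H = K.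
Proof.
move=> f1 /(carries_eq f1) defK; apply/eqP; rewrite -val_eqE /=.
rewrite (eq_subG_cyclic cycG) ?subsetT // defK card_imset //; exact: perm_inj.
Qed.

Definition powers k X := [set x ^+ k | x in X].

Lemma expg_inj k : coprime #|gT| k -> injective (fun x : gT => x ^+ k).
Proof.
by rewrite -cardsT => co_k x y; apply: (can_in_inj (expgK co_k)); rewrite inE.
Qed.

(** Induction over the prime factors of [k]: for a prime p not dividing |G|, p-th roots are unique,
    so the counts of [carries_power_count] are 0 or 1 and their congruence modulo p is an
    equality. *)
Lemma carries_powers f X Y k :
  coprime #|gT| k -> carries f X Y -> carries f (powers k X) (powers k Y).
Proof.
elim/ltn_ind: k X Y => k IHk X Y co_k fXY.
have [k_le1 | k_gt1] := leqP k 1.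
  suffices pow_id Z : powers k Z = Z by rewrite !pow_id.
  (* The exponent 0 is coprime to |G| only when G is trivial. *)
  rewrite -[RHS]imset_id; apply: eq_imset => x /=; case: k k_le1 co_k {IHk} => [|[|k]] // _.
  rewrite /coprime gcdn0 -cardsT => /eqP/card1_trivg G1.
  by have := in_setT x; rewrite G1 => /set1P.
have p_pr := pdiv_prime k_gt1; have [k' Dk] := dvdnP (pdiv_dvd k).
set p := pdiv k in p_pr Dk.
have [co_k' co_p] : coprime #|gT| k' /\ coprime #|gT| p.
  by move: co_k; rewrite Dk coprimeMr => /andP[].
have pow_comp Z : powers k Z = powers k' (powers p Z).
  rewrite /powers -imset_comp; apply: eq_imset => x /=.
  by rewrite -expgM mulnC -Dk.
rewrite !pow_comp; apply: IHk => // [|u v].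
  rewrite [ltnRHS]Dk -[ltnLHS]muln1 ltn_mul2l prime_gt1 // andbT.
  by case: (k') Dk k_gt1 => // ->.
have count_mem (Z : {set gT}) (w : gT) : #|[set z in Z | z ^+ p == w]| = (w \in powers p Z).
  apply/eqP; have [/imsetP[z Zz ->]|notZw] := boolP (w \in _).
    apply/cards1P; exists z; apply/setP=> x; rewrite !inE.
    rewrite (inj_eq (expg_inj co_p)) andb_idl // => /eqP-> //.
  rewrite cards_eq0 -subset0; apply/subsetP=> z; rewrite inE => /andP[Zz /eqP Dw].
  by case/imsetP: notZw; exists z.
have := carries_power_count abG p_pr u v fXY; rewrite !count_mem.
have b_mod (b : bool) : b %% p = b by rewrite modn_small //; case: b; rewrite ?prime_gt1 ?prime_gt0.
by rewrite !b_mod; do 2!case: (_ \in _).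
Qed.

Lemma carries_quotient f R : carries f R R ->
  exists fq : {perm coset_of R}, forall x, fq (coset R x) = coset R (f x).
Proof.
move=> fR; have nR x : x \in 'N(R) by apply: (subsetP (sub_abelian_norm abG (subsetT R))).
have coset_eq x y : (coset R x == coset R y) = (x * y^-1 \in R).
  by rewrite -mem_rcoset; apply: (sameP eqP (rcoset_kercosetP (nR x) (nR y))).
pose g (C : coset_of R) := coset R (f (repr C)).
have gE x : g (coset R x) = coset R (f x).
  by apply/eqP; rewrite coset_eq fR -coset_eq coset_reprK.
have g_inj : injective g.
  move=> C D; rewrite -(coset_reprK C) -(coset_reprK D) !gE => /eqP.
  by rewrite coset_eq fR -coset_eq => /eqP.
by exists (perm g_inj) => x; rewrite permE gE.
Qed.

(** As a union of cosets of [R], [X] is determined by its image in G / R, which the permutation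
    induced by [f] therefore preserves; the count is then taken in G / R. *)
Lemma carries_coset_power_count f X R p u v : prime p ->
    (forall x r, x \in X -> r \in R -> x * r \in X) ->
    carries f R R -> carries f X X ->
  let c y := #|[set C in [set coset R x | x in X] | C ^+ p == coset R y]| in
  c (v * u^-1) = c (f v * (f u)^-1) %[mod p].
Proof.
move=> p_pr XR fR fX c.
have nR x : x \in 'N(R) by apply: (subsetP (sub_abelian_norm abG (subsetT R))).
have cosetM x y : coset R (x * y^-1) = coset R x * (coset R y)^-1.
  by rewrite morphM ?morphV ?groupV ?nR.
have mem_X x : (coset R x \in [set coset R y | y in X]) = (x \in X).
  apply/imsetP/idP=> [[y Xy /(rcoset_kercosetP (nR x) (nR y))]|Xx]; last by exists x.
  by rewrite mem_rcoset => Rxy; rewrite -(mulgKV y x) mulC XR.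
have [fq fqE] := carries_quotient fR.
have abQ : abelian [set: coset_of R].
  suff -> : [set: coset_of R] = [set: gT] / R by apply: quotient_abelian.
  apply/setP=> C; rewrite inE -(coset_reprK C); symmetry.
  by apply: mem_quotient; rewrite inE.
have fqX : carries fq [set coset R x | x in X] [set coset R x | x in X].
  move=> C D; rewrite -(coset_reprK C) -(coset_reprK D) !fqE.
  by rewrite -!cosetM !mem_X.
have := carries_power_count abQ p_pr (coset R u) (coset R v) fqX.
by rewrite !fqE /c !cosetM.
Qed.

(** * Subgroups of a cyclic group and their orders *)

Lemma cyclic_memE H x : (x \in H) = (x ^+ #|H| == 1).
Proof.
by rewrite -order_dvdn (cardSg_cyclic cycG) ?subsetT // cycle_subG.
Qed.

Lemma cyclic_subE H K : (H \subset K) = (#|H| %| #|K|).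
Proof. by rewrite (cardSg_cyclic cycG) ?subsetT. Qed.

Lemma group_set_exponent d : group_set [set x : gT | x ^+ d == 1].
Proof.
apply/group_setP; split=> [|x y]; first by rewrite inE expg1n.
by rewrite !inE expgMC => /eqP-> /eqP->; rewrite mulg1.
Qed.
Definition exponent_group d := Group (group_set_exponent d).

Lemma dvdn_card_exponent_group d : #|exponent_group d| %| d.
Proof.
have /cyclicP[x Dx] := cyclicS (subsetT (exponent_group d)) cycG.
have : x \in exponent_group d by rewrite Dx cycle_id.
by rewrite inE -order_dvdn Dx.
Qed.

Lemma card_exponent_group d : d %| #|gT| -> #|exponent_group d| = d.
Proof.
rewrite -cardsT => dG; apply/eqP; rewrite eqn_dvd dvdn_card_exponent_group andTb.
have [g Dg] := cyclicP cycG; rewrite Dg -orderE in dG.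
have sub : <[g ^+ (#[g] %/ d)]> \subset exponent_group d.
  by rewrite cycle_subG inE -expgM divnK // expg_order.
suff o_g : #[g ^+ (#[g] %/ d)] = d by rewrite -{1}o_g; apply: cardSg.
rewrite orderXdiv ?dvdn_div //; case/dvdnP: dG (order_gt0 g) => e ->.
by rewrite muln_gt0 => /andP[e_gt0 d_gt0]; rewrite mulnK // mulKn.
Qed.
End Carries.

(** * Stable sets and radicals *)

Section Stable.
Variables (gT : finGroupType) (A : {group {perm gT}}).
Hypothesis cycG : cyclic [set: gT].
Implicit Types (f : {perm gT}) (X Y : {set gT}) (H J K R W : {group gT}).

Local Notation mulC := (cyclic_mulC cycG).

(** When [A] contains the right translations, these are the unions of basic sets of the Schur ring
    of [A]. *)
Definition stable X :=
  [forall a in A, forall u, forall v, (a v * (a u)^-1 \in X) == (v * u^-1 \in X)].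

Lemma stableP X : reflect (forall a, a \in A -> carries a X X) (stable X).
Proof.
apply: (iffP forall_inP) => [stX a Aa u v | stX a Aa].
  by have /forallP/(_ u)/forallP/(_ v)/eqP := stX a Aa.
by apply/forallP=> u; apply/forallP=> v; rewrite stX.
Qed.

Lemma stableT : stable [set: gT].
Proof. by apply/stableP=> a _ u v; rewrite !inE. Qed.

Lemma stableI X Y : stable X -> stable Y -> stable (X :&: Y).
Proof.
by move=> /stableP stX /stableP stY; apply/stableP=> a Aa u v; rewrite !inE stX ?stY.
Qed.

Lemma stableU X Y : stable X -> stable Y -> stable (X :|: Y).
Proof.
by move=> /stableP stX /stableP stY; apply/stableP=> a Aa u v; rewrite !inE stX ?stY.
Qed.

Lemma stableD X Y : stable X -> stable Y -> stable (X :\: Y).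
Proof.
by move=> /stableP stX /stableP stY; apply/stableP=> a Aa u v; rewrite !inE stX ?stY.
Qed.

Lemma stable_gen X : stable X -> stable <<X>>.
Proof. by move=> /stableP stX; apply/stableP=> a Aa; apply/carries_gen/stX. Qed.

Lemma stable_join H K : stable H -> stable K -> stable (H <*> K).
Proof. by move=> stH stK; apply/stable_gen/stableU. Qed.

Lemma stable_powers k X : coprime #|gT| k -> stable X -> stable (powers k X).
Proof. by move=> co_k /stableP stX; apply/stableP=> a /stX; apply: carries_powers. Qed.

Lemma stable_mem X a x : stable X -> a \in A -> a 1 = 1 -> (a x \in X) = (x \in X).
Proof. by move/stableP=> stX Aa a1; have := stX a Aa 1 x; rewrite a1 !invg1 !mulg1. Qed.

Lemma stable_group_mem H a x : stable H -> a \in A -> a 1 \in H -> (a x \in H) = (x \in H).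
Proof.
by move/stableP=> stH Aa a1; have := stH a Aa 1 x; rewrite invg1 mulg1 groupMr ?groupV.
Qed.

(* T is generated by R and the y having a number of p-th roots in X / R prime to p. *)
Lemma frobenius_group p X R : prime p -> stable X -> stable R ->
    (forall x r, x \in X -> r \in R -> x * r \in X) ->
  exists T : {group gT}, [/\ stable T, R \subset T,
    forall W, R \subset W -> (forall x, x \in X -> x ^+ p \in W) -> T \subset W
  & forall x, x \in X ->
      x ^+ p \in T \/ (forall g, g ^+ p \in R -> x * g \in X)].
Proof.
move=> p_pr /stableP stX stR XR.
pose c y := #|[set C in [set coset R x | x in X] | C ^+ p == coset R y]|.
pose Psi := [set y | ~~ (p %| c y)].
have nR x : x \in 'N(R).
  by apply: (subsetP (sub_abelian_norm (cyclic_abelian cycG) (subsetT R))).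
have cosetE x y : reflect (coset R x = coset R y) (x * y^-1 \in R).
  by rewrite -mem_rcoset; apply: (equivP idP); split => /(rcoset_kercosetP (nR x) (nR y)).
have stPsi : stable Psi.
  apply/stableP=> a Aa u v; rewrite !inE /dvdn.
  by rewrite -(carries_coset_power_count cycG _ _ p_pr XR) //; [apply/stableP: a Aa | apply: stX].
exists (<<Psi>> <*> R)%G; split=> [||W sRW XW|x Xx].
- exact: stable_join (stable_gen stPsi) stR.
- exact: joing_subr.
- rewrite join_subG sRW andbT gen_subG; apply/subsetP=> y; rewrite inE => ndv.
  have /card_gt0P[C] : 0 < c y by case: (c y) ndv; rewrite ?dvdn0.
  rewrite inE => /andP[/imsetP[x Xx ->]]; rewrite -morphX ?nR // eq_sym.
  move=> /eqP/cosetE Ry; rewrite -(mulgKV (x ^+ p) y) groupM ?XW //.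
  exact: (subsetP sRW).
have [p_c | ndv] := boolP (p %| c (x ^+ p)); last first.
  by left; apply/(subsetP (joing_subl _ _))/mem_gen; rewrite inE.
right=> g Rgp.
have cycQ : cyclic [set: coset_of R].
  suff -> : [set: coset_of R] = [set: gT] / R by apply: quotient_cyclic.
  apply/setP=> C; rewrite inE -(coset_reprK C); symmetry.
  by apply: mem_quotient; rewrite inE.
pose Om := exponent_group cycQ p; pose D := coset R x.
have card_Om : #|Om| <= p := dvdn_leq (prime_gt0 p_pr) (dvdn_card_exponent_group cycQ p).
(* The p-th roots of [D ^+ p] in G / R form a coset of [Om], of size at most p. If the coset of
   [x * g] were missing, the count would lie strictly between 0 and p. *)
apply: contraLR p_c => notXxg; rewrite /c.
set F := [set C in _ | _]; have FD : D \in F.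
  by rewrite inE imset_f //= -morphX ?nR.
rewrite gtnNdvd //; first by apply/card_gt0P; exists D.
apply: leq_trans card_Om; rewrite -(card_rcoset F D^-1); apply: proper_card.
rewrite properE; apply/andP; split.
  apply/subsetP=> C; rewrite mem_rcoset invgK inE => /andP[_].
  by rewrite (expgMC cycQ) morphX ?nR // -/D -[X in _ == X]mul1g (inj_eq (mulIg _)) inE.
have Om_g : coset R g \in Om by rewrite inE -morphX ?nR //; apply/eqP/coset_id.
apply/negP=> /subsetP/(_ (coset R g) Om_g).
rewrite mem_rcoset invgK inE => /andP[/imsetP[y Xy]].
rewrite -morphM ?nR // => /cosetE Rgxy _; case/negP: notXxg.
by rewrite mulC -(mulgKV y (g * x)) mulC XR.
Qed.

(** * Radicals, local radicals and orbits *)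

Fact local_radical_group_set X J x :
  group_set [set g in J | [forall h in J, (x * h * g \in X) == (x * h \in X)]].
Proof.
apply/group_setP; split=> [|g1 g2].
  by rewrite inE group1; apply/forall_inP=> h _; rewrite mulg1.
rewrite !inE => /andP[Jg1 /forall_inP X1] /andP[Jg2 /forall_inP X2].
rewrite groupM //; apply/forall_inP=> h Jh; rewrite -(eqP (X1 h Jh)).
by have /eqP := X2 _ (groupM Jh Jg1); rewrite !mulgA => ->.
Qed.
(** The stabiliser in [J], under translation, of the part of [X] in the coset [x *: J]. *)
Definition local_radical X J x := Group (local_radical_group_set X J x).

Lemma leq_card_local_radical X J a x : stable X -> stable J -> a \in A ->
  a 1 \in J -> #|local_radical X J x| <= #|local_radical X J (a x)|.
Proof.
move=> stX stJ Aa Ja1; have /stableP/(_ a Aa) aX := stX.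
have /stableP/(_ a Aa) aJ := stJ.
have phi_inj : injective (fun g => a (x * g) * (a x)^-1).
  by move=> g1 g2 /mulIg/perm_inj/mulgI.
rewrite -(card_imset _ phi_inj); apply/subset_leq_card/subsetP=> _ /imsetP[g Lg ->].
move: Lg; rewrite !inE => /andP[Jg /forall_inP Xg].
rewrite aJ mulC mulKg Jg; apply/forall_inP=> h Jh.
(* Since [a] respects only quotients of two points, [h] is rewritten as the inverse of a value of
   [a]. *)
pose y := a^-1 h^-1; have Dh : h = (a y)^-1 by rewrite permKV invgK.
have Jy : y \in J.
  by rewrite -(stable_group_mem y stJ Aa Ja1) permKV groupV.
have -> : a x * h * (a (x * g) * (a x)^-1) = a (x * g) * h.
  by rewrite mulgA mulC -!mulgA mulKg mulC.
rewrite Dh !aX.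
have /eqP := Xg _ (groupVr Jy); rewrite -[x * _ * g]mulgA [_^-1 * g]mulC mulgA => ->.
by rewrite eqxx.
Qed.

Lemma eq_local_radical X J a x : stable X -> stable J -> a \in A ->
  a 1 \in J -> local_radical X J x = local_radical X J (a x).
Proof.
move=> stX stJ Aa Ja1; apply/eqP; rewrite -val_eqE (eq_subG_cyclic cycG) ?subsetT //.
rewrite eqn_leq leq_card_local_radical //=.
have := leq_card_local_radical (a x) stX stJ (groupVr Aa).
rewrite permK; apply.
by rewrite -(stable_group_mem _ stJ Aa Ja1) permKV group1.
Qed.

Definition radical X := local_radical X [set: gT] 1.

Lemma radicalP X g : reflect (forall x, (x * g \in X) = (x \in X)) (g \in radical X).
Proof.
rewrite inE in_setT; apply: (iffP forall_inP) => [Xg x | Xg x _].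
  by have /eqP := Xg x (in_setT x); rewrite mul1g.
by rewrite mul1g Xg.
Qed.

Lemma sub_radicalP X R :
  reflect (forall x r, x \in X -> r \in R -> x * r \in X) (R \subset radical X).
Proof.
apply: (iffP subsetP) => [sRX x r Xx /sRX/radicalP-> // | XR r Rr].
apply/radicalP=> x; apply/idP/idP=> [Xxr|Xx]; last exact: XR.
by rewrite -(mulgK r x) XR ?groupV.
Qed.

(** A quotient [z * w^-1] lies in the radical exactly when [z] and [w] have the same in-neighbours
    in Cay(G, X), a relation that automorphisms preserve. *)
Lemma stable_radical X : stable X -> stable (radical X).
Proof.
move/stableP=> stX; apply/stableP=> a Aa u v.
have radE w z : reflect (forall y, (z * y^-1 \in X) = (w * y^-1 \in X))
                        (z * w^-1 \in radical X).
  apply: (iffP (radicalP _ _)) => Xzw y.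
    by rewrite -(Xzw (w * y^-1)) [w * y^-1 * _]mulC mulgA mulgKV.
  have := Xzw (y^-1 * w); rewrite invMg invgK !mulgA mulgV mul1g => <-.
  by rewrite -mulgA mulC.
apply/radE/radE=> eq_uv y; last first.
  by rewrite -[y](permKV a) !(stX a Aa) eq_uv.
by rewrite -(stX a Aa y v) -(stX a Aa y u) eq_uv.
Qed.

(* An orbit of the setwise stabiliser of R, which is how one works modulo R without
   passing to a quotient group. *)
Definition block_orbit R X := [/\ stable X, R \subset radical X
  & forall x y, x \in X -> y \in X -> exists a, [/\ a \in A, a 1 \in R & a x = y]].

(** Transitivity makes the local radicals at all points of [X] equal, so invariance under [K]
    spreads from one coset of [J] to all of [X]. *)
Lemma sub_radical_local R X J K x1 : block_orbit R X -> stable J -> R \subset J ->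
    K \subset J -> x1 \in X ->
    (forall w g, w \in X -> w * x1^-1 \in J -> g \in K -> w * g \in X) ->
  K \subset radical X.
Proof.
move=> [stX _ trX] stJ sRJ sKJ Xx1 XK; apply/sub_radicalP=> x g Xx Kg.
have [a [Aa a1 ax1]] := trX _ _ Xx1 Xx.
suff : g \in local_radical X J x.
  by rewrite inE => /andP[_ /forall_inP/(_ 1 (group1 J))]; rewrite mulg1 Xx => /eqP.
rewrite -ax1 -(eq_local_radical _ stX stJ Aa) ?(subsetP sRJ) //.
rewrite inE (subsetP sKJ) //; apply/forall_inP=> h Jh.
have Jxh : x1 * h * x1^-1 \in J by rewrite mulC mulKg.
apply/eqP; apply/idP/idP=> [Xhg|Xh]; last exact: XK.
rewrite -(mulgK g (x1 * h)) XK ?groupV // -[_ * g * _]mulgA [g * _]mulC mulgA.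
by rewrite groupM // (subsetP sKJ).
Qed.

Definition orb R x : {set gT} := [set (a : {perm gT}) x | a in A & a 1 \in R].

Lemma orb_block_orbit R x : (forall g, perm (mulIg g) \in A) -> stable R ->
  block_orbit R (orb R x).
Proof.
move=> trA stR; have RV a : a \in A -> a 1 \in R -> a^-1 1 \in R.
  by move=> Aa a1; rewrite -(stable_group_mem _ stR Aa a1) permKV group1.
have orb_carries b u v : b \in A -> v * u^-1 \in orb R x -> b v * (b u)^-1 \in orb R x.
  move=> Ab /imsetP[a]; rewrite inE => /andP[Aa a1] Dv.
  (* Translating by [u] before [b] and by the inverse of [b u] after it sends [x] to
     [b v * (b u)^-1] and, [R] being stable, 1 into [R]. *)
  pose c := a * perm (mulIg u) * b * perm (mulIg (b u)^-1).
  have cE w : c w = b (a w * u) * (b u)^-1 by rewrite !permM !permE.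
  apply/imsetP; exists c; last by rewrite cE -Dv mulgKV.
  rewrite inE !groupM ?trA //= cE; have /stableP/(_ b Ab) -> := stR.
  by rewrite mulgK.
split.
- apply/stableP=> b Ab u v; apply/idP/idP; last exact: orb_carries.
  by move/(orb_carries _ _ _ (groupVr Ab)); rewrite !permK.
- apply/sub_radicalP=> y r /imsetP[a]; rewrite inE => /andP[Aa a1] -> Rr.
  apply/imsetP; exists (a * perm (mulIg r)); last by rewrite permM permE.
  by rewrite inE groupM ?trA //= permM permE groupM.
move=> y z /imsetP[a]; rewrite inE => /andP[Aa a1] ->.
move=> /imsetP[b]; rewrite inE => /andP[Ab b1] ->.
exists (a^-1 * b); split; rewrite ?groupM ?groupV ?permM ?permK //.
by rewrite (stable_group_mem _ stR) // RV.
Qed.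

Lemma mem_orb R x : x \in orb R x.
Proof. by apply/imsetP; exists 1; rewrite ?inE perm1 ?group1. Qed.

Lemma block_orbit_stable R X Y : block_orbit R X -> stable Y -> R \subset radical Y ->
  X :&: Y != set0 -> X \subset Y.
Proof.
move=> [_ _ trX] /stableP stY RY /set0Pn[x /setIP[Xx Yx]]; apply/subsetP=> y Xy.
have [a [Aa a1 <-]] := trX _ _ Xx Xy.
have := stY a Aa 1 x; rewrite invg1 mulg1 Yx => {}Yx.
by rewrite -(mulgKV (a 1) (a x)); move/sub_radicalP: RY; apply.
Qed.
End Stable.

(** * Orbits fill cosets *)

Section Core.
Variables (gT : finGroupType) (A : {group {perm gT}}).
Hypothesis cycG : cyclic [set: gT].
Hypothesis translA : forall g : gT, perm (mulIg g) \in A.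
Local Notation mulC := (cyclic_mulC cycG).

(* For a prime p with p^2 dividing |G / R|: P has order p |R_p|, W is the subgroup of index
   p, H is the largest stable subgroup not containing P and V the least containing R and P. *)
Variables (p : nat) (R P H V W : {group gT}).
Hypotheses (p_pr : prime p) (stR : stable A R) (stH : stable A H) (stV : stable A V).
Hypotheses (sRH : R \subset H) (sRV : R \subset V) (sPV : P \subset V) (nPH : ~~ (P \subset H)).
Hypothesis powP : forall g, g \in P -> g ^+ p \in R.
Hypothesis minV : forall K : {group gT}, stable A K -> R \subset K -> P \subset K -> V \subset K.
Hypothesis maxH : forall K : {group gT}, stable A K -> ~~ (P \subset K) -> K \subset H.
Hypothesis genVH : V <*> H = [set: gT].
Hypotheses (sPW : P \subset W) (sHW : H \subset W) (nGW : ~~ ([set: gT] \subset W)).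
Hypothesis powW : forall x, x ^+ p \in W.
Hypothesis rootH : forall x, x ^+ p \in H -> x \in P <*> H.
Hypothesis rootV : forall q, prime q -> exists2 v, v \in V & v ^+ q \notin H.

Lemma notVW : ~~ (V \subset W).
Proof. by apply: contra nGW => sVW; rewrite -genVH join_subG sVW. Qed.

Section Orbit.
Variables (X : {set gT}) (x0 : gT).
Hypotheses (boX : block_orbit A R X) (Xx0 : x0 \in X) (notHx0 : x0 \notin H).

Lemma block_orbit_mem a x : a \in A -> a 1 \in R -> (a x \in X) = (x \in X).
Proof.
move=> Aa Ra1; have [/stableP/(_ a Aa) aX /subsetP/(_ _ Ra1)/radicalP Xa1 _] := boX.
by have := aX 1 x; rewrite invg1 mulg1 => <-; rewrite -Xa1 mulgKV.
Qed.

Lemma block_orbit_notin x : x \in X -> x \notin H.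
Proof.
move=> Xx; apply: contra notHx0 => Hx.
have RH : R \subset radical H.
  by apply/sub_radicalP=> y r Hy /(subsetP sRH); apply: groupM.
apply: (subsetP (block_orbit_stable boX stH RH _)) => //.
by apply/set0Pn; exists x; rewrite inE Xx.
Qed.

(** The stable group [<<X>>] is not inside [H], so it contains [P] by maximality of [H], and then
    [V] by minimality of [V]. *)
Lemma sub_gen_block_orbit : V \subset <<X>>.
Proof.
have [stX RX _] := boX; have stK := stable_gen stX.
apply: (minV stK).
  apply/subsetP=> r Rr; have Xx0r : x0 * r \in X by move/sub_radicalP: RX; apply.
  by rewrite -(mulKg x0 r) groupM ?groupV ?mem_gen.
apply: contraR notHx0 => /(maxH stK)/subsetP; apply.
exact: mem_gen.
Qed.

(** The group [T] of [frobenius_group] lies in [W], so it cannot contain [P] and is contained in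
    [H]. Thus [x ^+ p] in [T] would put [x] in [P <*> H]. *)
Lemma block_orbit_transl x g : x \in X -> x \notin P <*> H -> g \in P -> x * g \in X.
Proof.
move=> Xx notPHx Pg; have [stX RX _] := boX.
move/sub_radicalP: RX => XR.
have [T [stT sRT minT powT]] := frobenius_group cycG p_pr stX stR XR.
have sTW : T \subset W by apply: minT => // ; apply: subset_trans sHW.
have nPT : ~~ (P \subset T).
  by apply: contra notVW => /(minV stT sRT) sVT; apply: subset_trans sTW.
have [Txp | -> //] := powT x Xx; last exact: powP.
by case/negP: notPHx; apply/rootH/(subsetP (maxH stT nPT)).
Qed.

(** Count pairs (u, x) with [u *: H] = [x *: H]: a point [x] of [X] has |H| partners if it lies in
    [U], and none otherwise. *)
Lemma sum_card_lcoset (U : {set gT}) : (forall u h, u \in U -> h \in H -> u * h \in U) ->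
  \sum_(u in U) #|X :&: u *: H| = (#|H| * #|X :&: U|)%N.
Proof.
move=> UH.
have cardE u : #|X :&: u *: H| = \sum_(x in X) (x \in u *: H).
  by rewrite -sum1_card -big_mkcondr; apply: eq_bigl => x; rewrite inE.
under eq_bigr => u _ do rewrite cardE.
rewrite exchange_big /= mulnC -sum_nat_const [RHS]big_mkcond [LHS]big_mkcond.
apply: eq_bigr => x _; rewrite inE; case: (x \in X) => //=.
have swap u : (x \in u *: H) = (u \in x *: H).
  by rewrite !mem_lcoset -groupV invMg invgK.
have [Ux | notUx] := boolP (x \in U).
  rewrite -(card_lcoset H x) -sum1_card big_mkcond [RHS]big_mkcond.
  apply: eq_bigr => u _; rewrite swap; case: lcosetP => [[h Hh ->]|_].
    by rewrite UH.
  by case: (u \in U).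
rewrite big1 // => u Uu; rewrite swap; case: lcosetP => // [[h Hh Du]].
by case/negP: notUx; rewrite -(mulgK h x) -Du UH ?groupV.
Qed.

Lemma eq_card_lcosets x y : x \in X -> y \in X -> #|X :&: x *: H| = #|X :&: y *: H|.
Proof.
have leq u v : u \in X -> v \in X -> #|X :&: u *: H| <= #|X :&: v *: H|.
  have [_ _ trX] := boX; move=> Xu Xv; have [a [Aa Ra1 <-]] := trX u v Xu Xv.
  rewrite -(card_imset _ (@perm_inj _ a)); apply/subset_leq_card/subsetP.
  move=> _ /imsetP[w /setIP[Xw uHw] ->]; rewrite inE block_orbit_mem // Xw /=.
  have /stableP/(_ a Aa) aH := stH.
  by move: uHw; rewrite !mem_lcoset mulC -aH mulC.
by move=> Xx Xy; apply/eqP; rewrite eqn_leq !leq.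
Qed.

Lemma card_near_part : #|X :&: P <*> H| < #|X :\: P <*> H|.
Proof.
have [x Xx notPHx] : exists2 x, x \in X & x \notin P <*> H.
  apply/subsetPn; apply: contra notVW => sXPH.
  apply: subset_trans sub_gen_block_orbit _; rewrite gen_subG.
  by apply: subset_trans sXPH _; rewrite join_subG sPW.
pose k := #|X :&: x *: H|; pose PH := (P <*> H)%G.
have k_gt0 : 0 < k by apply/card_gt0P; exists x; rewrite inE Xx lcoset_refl.
have sHPH : H \subset PH by apply: joing_subr.
have le1 : #|H| * #|X :&: PH| <= k * #|PH :\: H|.
  rewrite -sum_card_lcoset => [|u h PHu /(subsetP sHPH)]; last exact: groupM.
  (* [X] avoids [H], and every other coset of [H] in [PH] holds k points of [X] or none. *)
  rewrite (big_setID H) /= big1 ?add0n => [|u /setIP[_ Hu]].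
    rewrite mulnC -sum_nat_const leq_sum // => u _.
    have [->|[y /setIP[Xy uHy]]] := set_0Vmem (X :&: u *: H); first by rewrite cards0.
    by rewrite -(lcoset_eqP uHy) (eq_card_lcosets Xy Xx).
  apply/eqP; rewrite cards_eq0 -subset0; apply/subsetP=> y /setIP[Xy].
  by rewrite lcoset_id // => Hy; have := block_orbit_notin Xy; rewrite Hy.
(* Outside [P <*> H] the set [X] is invariant under [P], which permutes the cosets of [H] in
   [x *: PH] transitively; each of them holds at least k points. *)
have le2 : k * #|PH| <= #|H| * #|X :&: x *: PH|.
  rewrite -sum_card_lcoset => [|u h]; last first.
    by rewrite !mem_lcoset mulgA => PHu /(subsetP sHPH); apply: groupM.
  rewrite -(card_lcoset PH x) mulnC -sum_nat_const leq_sum // => u /lcosetP[w].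
  rewrite /= (joingC P) norm_joinEl; last first.
    apply: subset_trans (subsetT H) _.
    exact: sub_abelian_norm (cyclic_abelian cycG) (subsetT P).
  case/mulsgP=> h g Hh Pg -> ->.
  rewrite /k -(card_rcoset (X :&: x *: H) g); apply/subset_leq_card/subsetP=> y.
  rewrite mem_rcoset => /setIP[Xyg xHyg].
  have notPHyg : y * g^-1 \notin P <*> H.
    apply: contra notPHx => PHyg; rewrite -(mulgKV (y * g^-1) x) groupM //.
    by rewrite -groupV invMg invgK mulC (subsetP sHPH) // -mem_lcoset.
  rewrite inE -{1}(mulgKV g y) block_orbit_transl //=.
  have := xHyg; rewrite !mem_lcoset => Hxyg.
  suff -> : (x * (h * g))^-1 * y = h^-1 * (x^-1 * (y * g^-1)) by rewrite groupM ?groupV.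
  rewrite !invMg [RHS]mulC !mulgA; do 2!rewrite [_ * h^-1]mulC.
  by rewrite -!mulgA; congr (_ * _); rewrite mulC -!mulgA; congr (_ * _); apply: mulC.
have lt3 : #|PH :\: H| < #|PH|.
  by apply/proper_card/properP; split; [apply: subsetDl | exists 1; rewrite ?inE group1].
have lt4 : #|X :&: PH| < #|X :&: x *: PH|.
  rewrite -(ltn_pmul2l (cardG_gt0 H)); apply: leq_trans le2.
  by apply: leq_ltn_trans le1 _; rewrite ltn_pmul2l.
apply: leq_trans lt4 _; apply/subset_leq_card/subsetP=> y /setIP[Xy xPHy].
rewrite inE Xy andbT; apply: contra notPHx => PHy.
rewrite -(mulgKV y x) groupM // -groupV invMg invgK mulC.
by rewrite -mem_lcoset.
Qed.

End Orbit.

Lemma mem_cyclic_joing (K L : {group gT}) x : x \in K <*> L ->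
  exists k l, [/\ k \in K, l \in L & x = k * l].
Proof.
rewrite norm_joinEl; first by case/mulsgP=> k l Kk Ll ->; exists k, l.
apply: subset_trans (subsetT K) _.
exact: sub_abelian_norm (cyclic_abelian cycG) (subsetT L).
Qed.

Lemma sub_radical_group (K L : {group gT}) : K \subset L -> K \subset radical L.
Proof.
by move=> /subsetP sKL; apply/sub_radicalP=> x r Lx /sKL; apply: groupM.
Qed.

(** The radical of the orbit [X] of [g] turns out to be V ∩ H. As it does not contain [P], [X] must
    meet [P <*> H], in a point of V that reduces modulo the radical to a point of [P]. *)
Lemma far_translate g : g \in V -> g \notin H ->
  exists z a, [/\ z \in P, a \in A, a 1 \in R & a z = g].
Proof.
move=> Vg notHg; pose X := orb A R g; have Xg : g \in X := mem_orb A R g.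
have boX : block_orbit A R X := orb_block_orbit g translA stR.
have [stX sRX trX] := boX; pose R2 := radical X.
have notHX := block_orbit_notin boX Xg notHg.
have stR2 : stable A R2 := stable_radical cycG stX.
have sXV : X \subset V.
  apply: block_orbit_stable boX stV (sub_radical_group sRV) _.
  by apply/set0Pn; exists g; rewrite inE Xg.
have nPR2 : ~~ (P \subset R2).
  apply/negP=> /(minV stR2 sRX)/subsetP/(_ _ (groupVr Vg))/radicalP/(_ g).
  by rewrite mulgV Xg => X1; have := notHX 1 X1; rewrite group1.
have sR2H : R2 \subset H := maxH stR2 nPR2.
have sR2V : R2 \subset V.
  apply/subsetP=> r /radicalP/(_ g); rewrite Xg => /(subsetP sXV) Vgr.
  by rewrite -(mulKg g r) groupM ?groupV.
pose J := (V :&: H)%G; have stJ : stable A J := stableI stV stH.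
have sR2J : R2 \subset J by rewrite subsetI sR2V.
have sJR2 : J \subset R2.
  (* Otherwise a prime q divides the index of [R2] in [J], and the subgroup [K] of order q |R2| will
     be shown to preserve [X]. *)
  apply/negPn/negP; rewrite (cyclic_subE cycG) => ndvd.
  have /dvdnP[e De] : #|R2| %| #|J| := cardSg sR2J.
  have e_gt1 : 1 < e.
    by move: ndvd (cardG_gt0 J); rewrite De; case: e {De} => [|[|e]] //; rewrite mul1n dvdnn.
  have [q q_pr dvd_qe] := pdivP e_gt1.
  have dvd_qJ : (q * #|R2|)%N %| #|J| by rewrite De dvdn_mul.
  have dvd_qV : (q * #|R2|)%N %| #|V| := dvdn_trans dvd_qJ (cardSg (subsetIl V H)).
  have qV : q %| #|V| := dvdn_trans (dvdn_mulr _ (dvdnn q)) dvd_qV.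
  have VG : #|V| %| #|gT| by rewrite -cardsT cardSg ?subsetT.
  have /sub_radicalP XR2 := subxx R2.
  have [T [stT sR2T minT powT]] := frobenius_group cycG q_pr stX stR2 XR2.
  (* [W2] has index q in [V]; it contains [T] but not [V], so [T] cannot contain [P]. *)
  pose W2 := exponent_group cycG (#|V| %/ q).
  have sTW2 : T \subset W2.
    apply: minT => [|x /(subsetP sXV)].
      apply/subsetP=> r; rewrite (cyclic_memE cycG) inE => /eqP r1.
      have /dvdnP[d ->] : #|R2| %| #|V| %/ q.
        by rewrite -(dvdn_pmul2l (prime_gt0 q_pr)) [X in _ %| X]mulnC divnK.
      by rewrite mulnC expgM r1 expg1n.
    by rewrite (cyclic_memE cycG) inE -expgM mulnC divnK.
  have nVW2 : ~~ (V \subset W2).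
    rewrite (cyclic_subE cycG) card_exponent_group ?(dvdn_trans (dvdn_div qV)) //.
    have V_gt0 := cardG_gt0 V; rewrite gtnNdvd //; last by rewrite ltn_Pdiv ?prime_gt1.
    by rewrite divn_gt0 ?prime_gt0 // dvdn_leq.
  have nPT : ~~ (P \subset T).
    apply: contra nVW2 => sPT; apply: subset_trans sTW2.
    by apply: minV => //; apply: subset_trans sR2T.
  have sTH := maxH stT nPT.
  have [x Xx notHxq] : exists2 x, x \in X & x ^+ q \notin H.
    have [v Vv notHvq] := rootV q_pr.
    have [x Xx notx] : exists2 x, x \in X & x \notin exponent_group cycG (q * #|H|).
      apply/subsetPn; apply: contra notHvq => sXK.
      have := sub_gen_block_orbit boX Xg notHg.
      move/subset_trans/(_ _)/subsetP/(_ v Vv).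
      move/(_ (exponent_group cycG (q * #|H|))); rewrite gen_subG => /(_ sXK).
      by rewrite inE expgM (cyclic_memE cycG).
    by exists x => //; rewrite (cyclic_memE cycG) -expgM; move: notx; rewrite inE.
  pose K := exponent_group cycG (q * #|R2|).
  have sKJ : K \subset J.
    rewrite (cyclic_subE cycG).
    exact: dvdn_trans (dvdn_card_exponent_group cycG _) dvd_qJ.
  have : K \subset R2.
    apply: (sub_radical_local cycG boX stJ (subset_trans sRX sR2J) sKJ Xx).
    (* With [x], every point of [X] in [x *: J] has its q-th power outside [H], hence outside
       [T]. *)
    move=> w k Xw; rewrite inE => /andP[_ Hwx]; rewrite inE expgM => Kk.
    have [/(subsetP sTH) Hwq | ->] := powT w Xw; rewrite ?(cyclic_memE cycG) //.
    case/negP: notHxq.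
    have -> : x ^+ q = w ^+ q * ((w * x^-1) ^+ q)^-1.
      by rewrite (expgMC cycG) expgVn invMg invgK mulC mulgKV.
    by rewrite groupM ?groupV // groupX.
  rewrite (cyclic_subE cycG) card_exponent_group; last first.
    exact: dvdn_trans dvd_qV VG.
  by rewrite gtnNdvd ?cardG_gt0 // ltn_Pmull ?prime_gt1 ?cardG_gt0.
have [x Xx PHx] : exists2 x, x \in X & x \in P <*> H.
  apply/exists_inP; apply: contraR nPR2; rewrite negb_exists_in => /forall_inP noPH.
  by apply/sub_radicalP=> x z Xx Pz; apply: (block_orbit_transl boX) (noPH x Xx) Pz.
have [z [h [Pz Hh Dx]]] := mem_cyclic_joing PHx; have Vz := subsetP sPV z Pz.
have R2h : h \in R2.
  apply: (subsetP sJR2); rewrite inE Hh andbT -(mulKg z h) -Dx.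
  by rewrite groupM ?groupV // (subsetP sXV).
have Xz : z \in X by have /radicalP <- := R2h; rewrite -Dx.
by have [a [Aa Ra1 Daz]] := trX z g Xz Xg; exists z, a.
Qed.

Section Exits.
Variables (X : {set gT}) (x0 : gT).
Hypotheses (boX : block_orbit A R X) (Xx0 : x0 \in X) (notHx0 : x0 \notin H).

(** The automorphism from [far_translate] maps [X :* z :\: X] onto [X :* g :\: X], and translation
    by [z] in [P] moves only points of [P <*> H] out of [X]. *)
Lemma leq_card_shift g : g \in V -> g \notin H ->
  #|X :* g :\: X| <= #|X :&: P <*> H|.
Proof.
move=> Vg notHg; have [z [a [Pz Aa Ra1 <-]]] := far_translate Vg notHg.
have [/stableP/(_ a Aa) aX _ _] := boX.
have le_z : #|X :* z :\: X| <= #|X :&: P <*> H|.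
  rewrite -(card_rcoset (X :&: _) z); apply/subset_leq_card/subsetP=> w.
  rewrite inE !mem_rcoset => /andP[notXw Xwz]; rewrite inE Xwz /=.
  by apply: contraR notXw => notPH; rewrite -(mulgKV z w) block_orbit_transl.
apply: leq_trans le_z; rewrite -(card_imset (X :* z :\: X) (@perm_inj _ a)).
apply/subset_leq_card/subsetP=> w; rewrite -[w](permKV a) inE mem_rcoset aX.
rewrite block_orbit_mem // => /andP[notXw Xwz].
by apply: imset_f; rewrite inE notXw mem_rcoset.
Qed.

(** By transitivity all points have equally many exits. [leq_card_shift] bounds their average, and
    [card_near_part] puts it below half of |V \ H|. *)
Lemma few_exits x : x \in X ->
  2 * #|[set v in V :\: H | x * v \notin X]| < #|V :\: H|.
Proof.
move=> Xx; pose D := V :\: H; pose ex y := #|[set v in D | y * v \notin X]|.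
have [stX _ trX] := boX; have /stableP stD := stableD stV stH.
have D_gt0 : 0 < #|D|.
  have [z Pz notHz] := subsetPn nPH; apply/card_gt0P; exists z.
  by rewrite inE notHz (subsetP sPV).
have ex_ge y : y \in X -> ex x <= ex y.
  move=> Xy; have [a [Aa Ra1 <-]] := trX x y Xx Xy.
  have phi_inj : injective (fun v => a (x * v) * (a x)^-1).
    by move=> v1 v2 /mulIg/perm_inj/mulgI.
  rewrite /ex -(card_imset _ phi_inj); apply/subset_leq_card/subsetP.
  move=> w /imsetP[v]; rewrite inE => /andP[Dv notXxv] ->; rewrite inE.
  by rewrite stD // mulC mulKg Dv mulC mulgKV block_orbit_mem.
(* Both sides count the pairs (y, g) in X x D with y g outside X. *)
have sum_ex : \sum_(y in X) ex y = \sum_(g in D) #|X :* g :\: X|.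
  have -> : \sum_(g in D) #|X :* g :\: X| =
            \sum_(g in D) \sum_(y in X) ((y * g)%g \notin X).
    apply: eq_bigr => g _; rewrite -(card_rcoset (_ :\: _) g^-1) -sum1_card.
    rewrite big_mkcond [RHS]big_mkcond; apply: eq_bigr => y _ /=.
    by rewrite mem_rcoset invgK inE mem_rcoset mulgK andbC; case: (y \in X); case: (_ \in X).
  rewrite exchange_big /=; apply: eq_bigr => y _; rewrite /ex -sum1_card.
  rewrite big_mkcond [RHS]big_mkcond; apply: eq_bigr => v _; rewrite inE.
  by case: (v \in D); case: (_ \in X).
have le1 : #|X| * ex x <= #|D| * #|X :&: P <*> H|.
  apply: (@leq_trans (\sum_(y in X) ex y)).
    by rewrite -sum_nat_const leq_sum.
  rewrite sum_ex -sum_nat_const; apply: leq_sum => g; rewrite inE => /andP[notHg Vg].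
  exact: leq_card_shift.
have X_gt0 : 0 < #|X| by apply/card_gt0P; exists x.
have lt2 : 2 * #|X :&: P <*> H| < #|X|.
  by rewrite -(cardsID (P <*> H) X) mul2n -addnn ltn_add2l (card_near_part boX Xx0 notHx0).
rewrite -(ltn_pmul2l X_gt0) mulnCA -/(ex x) -/D.
apply: leq_ltn_trans (leq_mul (leqnn 2) le1) _.
by rewrite mulnCA [ltnRHS]mulnC ltn_pmul2l.
Qed.

End Exits.

(** By [few_exits], [S] and the orbit of [y] each fill more than half of the coset [s *: V] outside
    [H]. So they meet, and [S] contains the orbit. *)
Lemma block_orbit_far S s y : block_orbit A R S -> s \in S -> s \notin H ->
  y * s^-1 \in V -> y \notin H -> y \in S.
Proof.
move=> boS Ss notHs Vys notHy; have Xy : y \in orb A R y := mem_orb A R y.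
have boX := orb_block_orbit y translA stR.
pose D := V :\: H; set X := orb A R y in Xy boX.
have most Z z : block_orbit A R Z -> z \in Z -> z \notin H ->
    #|D| < 2 * #|Z :&: z *: V|.
  move=> boZ Zz notHz; have := few_exits boZ Zz notHz Zz; rewrite -/D.
  set F := [set v in _ | _]; have := cardsID F D.
  have -> : D :&: F = F by apply/setIidPr/subsetP=> v; rewrite inE => /andP[].
  have : #|D :\: F| <= #|Z :&: z *: V|.
    rewrite -(card_lcoset (D :\: F) z); apply/subset_leq_card/subsetP=> w.
    rewrite mem_lcoset => /setDP[Dv nF]; move: nF; rewrite inE Dv. rewrite negbK mulKVg.
    by rewrite inE mem_lcoset => ->; move: Dv; rewrite inE => /andP[_ ->].
  move=> le_c <-; rewrite mul2n -addnn ltn_add2l => lt_F.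
  by apply: leq_trans (leq_mul (leqnn 2) le_c); rewrite mul2n -addnn ltn_add2r.
(* Since G = VH, the coset [s *: V] has a representative in [H], so it has as many points outside
   [H] as [V] does. *)
have [v [h [Vv Hh Ds]]] : exists v h, [/\ v \in V, h \in H & s = v * h].
  by apply: mem_cyclic_joing; rewrite genVH inE.
have sV : s *: V = h *: V.
  by apply/lcoset_eqP; rewrite mem_lcoset Ds (mulC v) mulKg.
have yV : y *: V = s *: V by apply/lcoset_eqP; rewrite mem_lcoset mulC.
have card_sV : #|(s *: V) :\: H| = #|D|.
  rewrite sV -(card_lcoset D h); apply: eq_card => w.
  by rewrite in_setD !mem_lcoset in_setD (groupMl w (groupVr Hh)).
have in_sV Z z : block_orbit A R Z -> z \in Z -> z \notin H -> Z :\: H = Z.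
  move=> boZ Zz notHz; apply/setDidPl; rewrite disjoints_subset.
  by apply/subsetP=> w /(block_orbit_notin boZ Zz notHz); rewrite inE.
have [w] : exists w, w \in (S :&: s *: V) :&: (X :&: s *: V).
  apply/set0Pn; rewrite -card_gt0.
  have := most S s boS Ss notHs; have := most X y boX Xy notHy; rewrite yV.
  have := cardsUI (S :&: s *: V) (X :&: s *: V).
  have : #|(S :&: s *: V) :|: (X :&: s *: V)| <= #|D|.
    rewrite -card_sV subset_leq_card // -setIUl -(in_sV S s) // -(in_sV X y) //.
    by rewrite -setDUl setIC setIDA setSD // subsetIl.
  move=> leU eqUI ltX ltS.
  rewrite -(ltn_add2l #|S :&: s *: V :|: X :&: s *: V|) addn0 eqUI.
  rewrite -(ltn_pmul2l (isT : 0 < 2)) mulnDr mul2n -addnn.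
  by apply: leq_ltn_trans (leq_add leU leU) _; rewrite -addSn leq_add // ltnW.
rewrite !inE => /andP[/andP[Sw _] /andP[Xw _]].
have [stS RS _] := boS.
apply: (subsetP (block_orbit_stable boX stS RS _)) Xy.
by apply/set0Pn; exists w; rewrite inE Xw.
Qed.
End Core.

(** * Filling cosets of a Sylow subgroup *)

Lemma dvdn_pfactor_mul p i j m t : prime p -> t %| p ^ i * m -> ~~ (p ^ j.+1 %| t) ->
  t %| p ^ j * m.
Proof.
move=> p_pr t_im; have [->|m_gt0] := posnP m.
  by rewrite !muln0 dvdn0.
have im_gt0 : 0 < p ^ i * m by rewrite muln_gt0 expn_gt0 prime_gt0.
have t_gt0 := dvdn_gt0 im_gt0 t_im.
rewrite pfactor_dvdn // -ltnNge ltnS => le_tj.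
rewrite -(partnC p t_gt0) dvdn_mul ?p_part ?dvdn_exp2l //.
have := partn_dvd p^' im_gt0 t_im; rewrite partnM ?expn_gt0 ?(prime_gt0 p_pr) //.
rewrite (@part_p'nat p^' (p ^ i)%N) ?mul1n; last by rewrite pnatNK pnatX pnat_id.
by move/dvdn_trans; apply; apply: dvdn_part.
Qed.

Lemma mem_group_coprime_exp (gT : finGroupType) (K : {group gT}) x i j :
  coprime i j -> x ^+ i \in K -> x ^+ j \in K -> x \in K.
Proof.
have [-> | i_gt0] := posnP i.
  by rewrite /coprime gcd0n => /eqP-> _; rewrite expg1.
move=> co_ij Ki Kj; have [u v Duv _] := egcdnP j i_gt0.
move: co_ij Duv => /eqP-> Duv.
have : x ^+ (u * i) \in K by rewrite mulnC expgM groupX.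
by rewrite Duv addn1 expgSr groupMl // mulnC expgM groupX.
Qed.

Section Fill.
Variables (gT : finGroupType) (A : {group {perm gT}}).
Hypothesis cycG : cyclic [set: gT].
Hypothesis translA : forall g : gT, perm (mulIg g) \in A.
Local Notation mulC := (cyclic_mulC cycG).

(** Let p^(a - b) be the p-part of |G / R|. If a = b, [R] contains the Sylow p-subgroup; if a = b +
    1, [frobenius_group] suffices; otherwise the work is to check the hypotheses of
    [block_orbit_far]. *)
Lemma block_orbit_fill (S : {set gT}) (p : nat) (s y : gT) : block_orbit A 1%G S ->
    <<S>> = [set: gT] -> prime p -> s \in S ->
    s ^+ (#|gT| %/ p) = 1 -> y ^+ (#|gT| %/ p) != 1 -> (y * s^-1) ^+ #|gT|`_p = 1 ->
  y \in S.
Proof.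
move=> boS genS p_pr Ss; have [stS _ trS] := boS; have p_gt0 := prime_gt0 p_pr.
have n_gt0 : 0 < #|gT| by rewrite -cardsT cardG_gt0.
rewrite p_part; set n := #|gT| in n_gt0 *; set a := logn p n.
pose R := radical S; have stR : stable A R := stable_radical cycG stS.
have /sub_radicalP SR : R \subset radical S := subxx R.
have Rn : #|R| %| n by rewrite /n -cardsT cardSg ?subsetT.
set b := logn p #|R|; have le_ba : b <= a by apply: dvdn_leq_log.
have dvd_bR : p ^ b %| #|R| by apply: pfactor_dvdnn.
have in_R x i : i %| #|R| -> x ^+ i = 1 -> x \in R.
  by case/dvdnP=> d Dd x1; rewrite (cyclic_memE cycG) Dd mulnC expgM x1 expg1n.
pose m := (n`_p^')%N; have Dn : n = (p ^ a * m)%N by rewrite -p_part partnC.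
have co_pm : coprime p m by rewrite prime_coprime // -p'natE // part_pnat.
have m_gt0 : 0 < m by apply: part_gt0.
pose W := exponent_group cycG (n %/ p); rewrite -/n.
move=> s1 y1 ys1; have Ws : s \in W by rewrite inE s1.
have notWy : y \notin W by rewrite inE.
have defy : y = s * (y * s^-1) by rewrite mulC mulgKV.
have [lt_ba | ge_ba] := ltnP b a; last first.
  by rewrite defy SR // (in_R _ (p ^ a)%N) //; apply: dvdn_trans dvd_bR; apply: dvdn_exp2l.
have Dnp : (n %/ p = p ^ a.-1 * m)%N.
  by rewrite Dn -{1}(prednK (leq_ltn_trans (leq0n b) lt_ba)) expnS -mulnA mulKn.
have a_gt0 : 0 < a := leq_ltn_trans (leq0n b) lt_ba.
have pn : p %| n by rewrite Dn dvdn_mulr // -(prednK a_gt0) dvdn_exp.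
have nGW : ~~ ([set: gT] \subset W) by apply/subsetPn; exists y.
have boSR : block_orbit A R S.
  split; rewrite ?subxx // => x z Sx Sz; have [c [Ac /set1P c1 Dz]] := trS x z Sx Sz.
  by exists c; rewrite c1 group1.
(* With the p-part of [R] and the full p'-part of G, [E] is the largest subgroup not containing the
   group [P] below. *)
pose E := exponent_group cycG (p ^ b * m).
have pbm_n : (p ^ b * m)%N %| n by rewrite Dn dvdn_mul // dvdn_exp2l.
have sEW : E \subset W.
  rewrite (cyclic_subE cycG) !card_exponent_group ?dvdn_div // Dnp dvdn_mul //.
  by rewrite dvdn_exp2l // -ltnS prednK.
pose P := exponent_group cycG (p ^ b.+1).
have card_P : #|P| = (p ^ b.+1)%N.
  by rewrite card_exponent_group // -/n Dn dvdn_mulr // dvdn_exp2l.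
have sub_E (K : {group gT}) : ~~ (P \subset K) -> K \subset E.
  rewrite !(cyclic_subE cycG) card_P card_exponent_group //.
  by apply: (@dvdn_pfactor_mul p a) => //; rewrite -Dn /n -cardsT cardSg ?subsetT.
have nPE : ~~ (P \subset E).
  rewrite (cyclic_subE cycG) card_P card_exponent_group // expnSr.
  by rewrite dvdn_pmul2l ?expn_gt0 ?p_gt0 // -prime_coprime.
have nPR : ~~ (P \subset R).
  by rewrite (cyclic_subE cycG) card_P pfactor_dvdn ?cardG_gt0 // -/b ltnn.
have sRW : R \subset W := subset_trans (sub_E R nPR) sEW.
have powW x : x ^+ p \in W.
  rewrite inE -expgM mulnC divnK // -order_dvdn /n -cardsT order_dvdG ?inE //.
have [T [stT sRT minT powT]] := frobenius_group cycG p_pr stS stR SR.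
have sTW : T \subset W by apply: minT.
have not_sub_W (K : {group gT}) : S \subset K -> K \subset W -> False.
  move=> sSK sKW; case/negP: nGW; apply: subset_trans sKW.
  by rewrite -genS gen_subG.
have [b1a | ltb1a] := eqVneq b.+1 a.
  have notTs : s \notin T.
    apply/negP=> Ts; apply: (not_sub_W T) sTW.
    apply: (block_orbit_stable boS stT).
      by apply: subset_trans (sub1G _) _.
    by apply/set0Pn; exists s; rewrite inE Ss.
  (* [s ^+ m] has order dividing p^b and so lies in [R]; together with [s ^+ p] in [T] this would
     put [s] in [T]. *)
  have [Tsp | sS] := powT s Ss.
    case/negP: notTs; apply: (mem_group_coprime_exp co_pm Tsp).
    apply/(subsetP sRT)/(in_R _ (p ^ b)%N) => //.
    by rewrite -expgM mulnC -{1}[b]/(b.+1.-1) b1a -Dnp.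
  rewrite defy; apply/sS/(in_R _ (p ^ b)%N) => //.
  by rewrite -expgM -expnS b1a.
have {ltb1a} lt_b1a : b.+1 < a by rewrite ltn_neqAle ltb1a.
have sPW : P \subset W.
  rewrite (cyclic_subE cycG) card_P card_exponent_group ?dvdn_div // Dnp.
  by rewrite dvdn_mulr // dvdn_exp2l // -ltnS prednK.
(* S is fixed by the powers u = 1 + m k, which move x through the whole of x P. *)
have transl_units x g : x \in S -> x \notin W -> g \in P -> x * g \in S.
  move=> Sx notWx Pg.
  have xm_pa : (x ^+ m) ^+ (p ^ a) == 1.
    by rewrite -expgM mulnC -Dn -order_dvdn /n -cardsT order_dvdG ?inE.
  have o_xm : #[x ^+ m] = (p ^ a)%N.
    have := xm_pa; rewrite -order_dvdn => /(dvdn_pfactor _ _ p_pr)[i le_ia Di].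
    rewrite Di; congr (p ^ _)%N; apply/eqP; rewrite eqn_leq le_ia /=.
    rewrite leqNgt; apply: contra notWx => lt_ia.
    rewrite inE Dnp mulnC expgM -order_dvdn Di dvdn_exp2l //.
    by rewrite -ltnS prednK.
  have /cycleP[k Dg] : g \in <[x ^+ m]>.
    apply: (subsetP _ g Pg); rewrite (cyclic_subE cycG) card_P -orderE o_xm.
    by rewrite dvdn_exp2l // ltnW.
  have dvd_k : (p ^ a)%N %| (k * p ^ b.+1)%N.
    by rewrite -o_xm order_dvdn expgM -Dg; move: Pg; rewrite inE.
  have p_k : p %| k.
    rewrite -(@dvdn_pmul2r (p ^ b.+1)) ?expn_gt0 ?p_gt0 //.
    by apply: dvdn_trans dvd_k; rewrite -expnS dvdn_exp2l.
  pose u := (m * k).+1.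
  have co_u : coprime #|gT| u.
    rewrite -/n Dn coprimeMl coprimeXl.
      by rewrite /coprime /u -addn1 mulnC gcdnMDl gcdn1.
    rewrite /u; have /dvdnP[e ->] := p_k.
    by rewrite /coprime mulnA -addn1 gcdnMDl gcdn1.
  (* Because [s] lies in [W] and p divides k p^b / p^(a - 2), the factor [s ^+ (m * k)] has order
     dividing p^b, hence lies in [R]. *)
  have Ssu : s ^+ u \in S.
    have /dvdnP[e De] : (p ^ a.-1)%N %| (k * p ^ b)%N.
      by rewrite -(dvdn_pmul2l p_gt0) -expnS prednK // mulnCA -expnS.
    rewrite expgS SR // (in_R _ (p ^ b)%N) //.
    by rewrite -expgM -mulnA De mulnCA mulnC [(m * _)%N]mulnC -Dnp expgM s1 expg1n.
  have sSSu : S \subset powers u S.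
    apply: (block_orbit_stable boS (stable_powers cycG co_u stS) (sub1G _)).
    by apply/set0Pn; exists (s ^+ u); rewrite inE Ssu; apply/imsetP; exists s.
  have /eqP defS : S == powers u S by rewrite eqEcard sSSu leq_imset_card.
  by rewrite Dg -expgM -expgS defS; apply/imsetP; exists x.
have [s1' Ss1 notWs1] : exists2 x, x \in S & x \notin W.
  by apply/subsetPn; apply/negP=> /not_sub_W/(_ (subxx W)).
have nPT : ~~ (P \subset T).
  (* The coset of [T] through a point outside [W] avoids [W], so [transl_units] would make [S]
     invariant under [P] there. *)
  apply: contra nPR => sPT; apply: (sub_radical_local cycG boSR stT sRT sPT Ss1).
  move=> w g Sw Tws1 Pg; apply: transl_units => //; apply: contra notWs1 => Ww.
  by rewrite -groupV -(groupMl _ Ww) (subsetP sTW).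
have [H maxH sRH] : {H : {group gT} | [max H | stable A H && (H \subset E)] & R \subset H}.
  by apply: maxgroup_exists; rewrite stR sub_E.
have /maxgroupP[/andP[stH sHE] maxH'] := maxH.
have {maxH'}maxH (K : {group gT}) : stable A K -> ~~ (P \subset K) -> K \subset H.
  move=> stK /sub_E sKE; rewrite -(maxH' (H <*> K)%G) ?joing_subr ?joing_subl //.
  by rewrite stable_join // join_subG sHE.
have [V minV] : {V : {group gT} | [min V | stable A V && (R <*> P \subset V)]
                                & V \subset [set: gT]}.
  by apply: mingroup_exists; rewrite stableT subsetT.
have /mingroupP[/andP[stV]] := minV; rewrite join_subG => /andP[sRV sPV] minV' _.
have {minV'}minV (K : {group gT}) : stable A K -> R \subset K -> P \subset K -> V \subset K.
  move=> stK sRK sPK; rewrite -(minV' (V :&: K)%G) ?subsetIr ?subsetIl //.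
  by rewrite stableI // join_subG !subsetI sRV sRK sPV.
have nPH : ~~ (P \subset H) by apply: contra nPE => /subset_trans; apply.
have powP g : g \in P -> g ^+ p \in R.
  by rewrite inE expnS expgM => /eqP; apply: in_R.
have sHW := subset_trans sHE sEW.
have rootH x : x ^+ p \in H -> x \in P <*> H.
  move=> Hxp; apply: (mem_group_coprime_exp co_pm).
    exact: (subsetP (joing_subr _ _)).
  apply: (subsetP (joing_subl _ _)); rewrite inE -expgM mulnC expnS -mulnA expgM.
  by move: (subsetP sHE _ Hxp); rewrite inE.
have genVH : V <*> H = [set: gT].
  apply/eqP; rewrite eqEsubset subsetT -genS gen_subG; apply/subsetP=> x Sx.
  (* If [S] meets [P <*> H] in the coset of [V] through [x], then [x] is in VH. If not, [powT] makes
     [S] invariant under [P] on that coset, forcing [P] into [R]. *)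
  have [/exists_inP[w Sw /andP[Vwx PHw]] | none] :=
      boolP [exists w in S, (w * x^-1 \in V) && (w \in P <*> H)].
    rewrite -groupV -(groupMl _ (_ : w \in V <*> H)).
      exact: (subsetP (joing_subl _ _)).
    apply: subsetP PHw; rewrite join_subG joing_subr andbT.
    exact: subset_trans sPV (joing_subl _ _).
  case/negP: nPR; apply: (sub_radical_local cycG boSR stV sRV sPV Sx).
  move=> w g Sw Vwx Pg; have [Twp | ] := powT w Sw; last by apply; apply: powP.
  case/exists_inP: none; exists w => //; rewrite Vwx /=.
  exact/rootH/(subsetP (maxH T stT nPT)).
pose Gp := exponent_group cycG (p ^ a).
have pan : (p ^ a)%N %| n by rewrite Dn dvdn_mulr.
have sGpV : Gp \subset V.
  have nVW : ~~ (V \subset W).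
    by apply: contra nGW => sVW; rewrite -genVH join_subG sVW.
  apply: contraR nVW; rewrite !(cyclic_subE cycG) card_exponent_group //.
  rewrite card_exponent_group ?dvdn_div // Dnp -{1}(prednK a_gt0).
  by apply: (@dvdn_pfactor_mul p a) => //; rewrite -Dn /n -cardsT cardSg ?subsetT.
have rootV q : prime q -> exists2 v, v \in V & v ^+ q \notin H.
  move=> q_pr; have /cyclicP[v Dv] := cyclicS (subsetT Gp) cycG.
  have o_v : #[v] = (p ^ a)%N by rewrite /order -Dv card_exponent_group.
  exists v; first by apply: (subsetP sGpV); rewrite Dv cycle_id.
  (* Modulo [E], [v] has order p^(a - b), a multiple of p^2, which cannot divide the prime q. *)
  apply/negP=> /(subsetP sHE); rewrite inE -expgM -order_dvdn o_v mulnA.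
  rewrite Gauss_dvdl ?coprimeXl // => dvd_q.
  have p2q : (p ^ 2)%N %| q.
    rewrite -(@dvdn_pmul2r (p ^ b)) ?expn_gt0 ?p_gt0 //.
    by apply: dvdn_trans dvd_q; rewrite -expnD dvdn_exp2l.
  have p_q : p %| q by apply: dvdn_trans p2q; rewrite dvdn_exp.
  have Dq : p = q by apply/eqP; rewrite -dvdn_prime2.
  by move: p2q; rewrite -Dq gtnNdvd // -{1}[p]expn1 ltn_exp2l ?prime_gt1.
have notHs : s \notin H.
  apply/negP=> Hs; apply: (not_sub_W H) sHW; apply: (block_orbit_stable boS stH).
    by apply: subset_trans (sub1G _) _.
  by apply/set0Pn; exists s; rewrite inE Ss.
apply: (block_orbit_far cycG translA p_pr stR stH stV sRH sRV sPV nPH powP minV maxH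
          genVH sPW sHW nGW powW rootH rootV boSR Ss notHs).
  by apply: (subsetP sGpV); rewrite inE ys1.
by apply: contra notWy; apply: (subsetP sHW).
Qed.
End Fill.

(** * Generators of G inside orbits *)

Section Generators.
Variables (gT : finGroupType).
Hypothesis cycG : cyclic [set: gT].
Implicit Types (A B : {group {perm gT}}) (S X : {set gT}).

Lemma stable1 A : stable A 1.
Proof.
apply/stableP=> a Aa u v; rewrite !inE -!eq_mulgV1; exact: inj_eq perm_inj _ _.
Qed.

Lemma block_orbit_powers A S k w : block_orbit A 1%G S -> coprime #|gT| k ->
  w \in S -> w \in powers k S -> powers k S = S.
Proof.
move=> boS co_k Sw kSw; have [stS _ _] := boS; apply/eqP; rewrite eq_sym.
rewrite eqEcard leq_imset_card andbT.
apply: (block_orbit_stable boS (stable_powers cycG co_k stS) (sub1G _)).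
by apply/set0Pn; exists w; rewrite inE Sw.
Qed.

(** The point [y] is corrected one prime at a time, with [block_orbit_fill] applied in [S] to [y]
    and in [X] to [y ^+ m]. *)
Lemma block_orbit_generator A B S X m y :
    (forall g : gT, perm (mulIg g) \in A) -> (forall g : gT, perm (mulIg g) \in B) ->
    block_orbit A 1%G S -> block_orbit B 1%G X ->
    <<S>> = [set: gT] -> <<X>> = [set: gT] -> coprime #|gT| m ->
    y \in S -> y ^+ m \in X ->
  exists w, [/\ w \in S, w ^+ m \in X & #[w] = #|gT|].
Proof.
move=> trA trB boS boX genS genX co_m; have n_gt0 : 0 < #|gT|.
  by rewrite -cardsT cardG_gt0.
have n_exp x : x ^+ #|gT| = 1 :> gT.
  by apply/eqP; rewrite -order_dvdn -cardsT order_dvdG ?inE.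
have : forall q, prime q -> q %| #|gT| -> y ^+ (#|gT| %/ q) = 1 -> q \in primes #|gT|.
  by move=> q q_pr qn _; rewrite mem_primes q_pr n_gt0.
(* The list always contains every prime q at which the q-part of [y] fails to generate the Sylow
   q-subgroup. *)
elim: (primes _) y => [|p ps IHps] y bad Sy Xy.
  exists y; split=> //; have dvd_yn : #[y] %| #|gT| by rewrite order_dvdn n_exp.
  have [e De] := dvdnP dvd_yn; have [e_le1 | e_gt1] := leqP e 1.
    by case: e e_le1 De n_gt0 => [|[|]] //; rewrite ?mul1n // => _ ->.
  have [q q_pr /dvdnP[d Dd]] := pdivP e_gt1.
  have Dn : #|gT| = (d * #[y] * q)%N by rewrite De Dd mulnAC.
  have := bad q q_pr; rewrite Dn dvdn_mull // mulnK ?prime_gt0 // mulnC.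
  by rewrite expgM expg_order expg1n => /(_ isT erefl).
have [/and3P[p_pr pn /eqP yp] | good_p] := boolP [&& prime p, p %| #|gT| & y ^+ (#|gT| %/ p) == 1].
  pose a := logn p #|gT|; have a_gt0 : 0 < a by rewrite logn_gt0 mem_primes p_pr n_gt0.
  have pan : (p ^ a)%N %| #|gT| by apply: pfactor_dvdnn.
  (* Multiplying by a generator [g] of the Sylow p-subgroup repairs p and affects no other prime. *)
  have /cyclicP[g Dg] := cyclicS (subsetT (exponent_group cycG (p ^ a))) cycG.
  have o_g : #[g] = (p ^ a)%N by rewrite /order -Dg card_exponent_group.
  have gp : g ^+ (#|gT| %/ p) != 1.
    rewrite -order_dvdn o_g; apply/negP=> pa_np.
    have : (p ^ a.+1)%N %| #|gT| by rewrite expnSr -(divnK pn) dvdn_mul.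
    by rewrite pfactor_dvdn // ltnn.
  have ygp : (y * g) ^+ (#|gT| %/ p) != 1 by rewrite (expgMC cycG) yp mul1g.
  have gpa : g ^+ (p ^ a) = 1 by rewrite -o_g expg_order.
  apply: (IHps (y * g)) => [q q_pr qn ygq||].
  - have ne_qp : q != p by apply: contra ygp => /eqP <-; rewrite ygq.
    suff yq : y ^+ (#|gT| %/ q) = 1.
      by have := bad q q_pr qn yq; rewrite inE (negPf ne_qp).
    move: ygq; rewrite (expgMC cycG); suff -> : g ^+ (#|gT| %/ q) = 1 by rewrite mulg1.
    apply/eqP; rewrite -order_dvdn o_g -(@Gauss_dvdl _ _ q) ?divnK //.
    by rewrite coprimeXl // prime_coprime // dvdn_prime2 // eq_sym.
  - apply: (block_orbit_fill cycG trA boS genS p_pr Sy yp ygp).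
    by rewrite p_part (cyclic_mulC cycG) mulKg.
  apply: (block_orbit_fill cycG trB boX genX p_pr Xy).
  - by rewrite -expgM mulnC expgM yp expg1n.
  - rewrite -expgM mulnC expgM; apply: contra ygp => /eqP ygpm.
    by rewrite -(inj_eq (expg_inj co_m)) /= expg1n; apply/eqP.
  rewrite p_part -expgVn -(expgMC cycG) (cyclic_mulC cycG) mulKg.
  by rewrite -expgM mulnC expgM gpa expg1n.
apply: (IHps y) => // q q_pr qn yq; have := bad q q_pr qn yq; rewrite inE.
case: eqP => // Dq; case/negP: good_p; rewrite -Dq q_pr qn; exact/eqP.
Qed.
End Generators.

(** * Automorphism groups of Cayley digraphs *)

Section CayleyAut.
Variable gT : finGroupType.
Implicit Type S : {set gT}.

Fact cay_aut_group_set S :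
  group_set [set a : {perm gT} | [forall u, forall v, cay_arc S (a u) (a v) == cay_arc S u v]].
Proof.
apply/group_setP; split=> [|a b].
  by rewrite inE; apply/forallP=> u; apply/forallP=> v; rewrite !perm1.
rewrite !inE => /forallP Sa /forallP Sb; apply/forallP=> u; apply/forallP=> v.
rewrite !permM; have /forallP/(_ (a v))/eqP -> := Sb (a u).
by have /forallP/(_ v) := Sa u.
Qed.
Definition cay_aut S := Group (cay_aut_group_set S).

Lemma cay_autP S (a : {perm gT}) : reflect (carries a S S) (a \in cay_aut S).
Proof.
rewrite inE; apply: (iffP forallP) => [Sa u v | Sa u].
  by have /forallP/(_ v)/eqP := Sa u.
by apply/forallP=> v; apply/eqP/Sa.
Qed.

Lemma cay_aut_transl S g : perm (mulIg g) \in cay_aut S.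
Proof. by apply/cay_autP=> u v; rewrite !permE invMg mulgA mulgK. Qed.

Lemma cay_aut_stable S : stable (cay_aut S) S.
Proof. by apply/stableP=> a /cay_autP. Qed.

Lemma arc_transitive_block_orbit S : arc_transitive (cay_arc S) ->
  block_orbit (cay_aut S) 1%G S.
Proof.
move=> atS; split; rewrite ?sub1G ?cay_aut_stable // => x y Sx Sy.
have [||a [Sa a1 ax]] := atS 1 x 1 y; rewrite /cay_arc ?invg1 ?mulg1 //.
by exists a; rewrite a1 set11; split=> //; apply/cay_autP=> u v; apply: Sa.
Qed.

Lemma connected_gen S : digraph_connected (cay_arc S) -> <<S>> = [set: gT].
Proof.
move=> connS; apply/eqP; rewrite eqEsubset subsetT; apply/subsetP=> y _.
have /connectP[p] := connS 1 y; have S1 := group1 <<S>>.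
elim: p 1 S1 => [|z p IHp] x Sx /=.
  by move=> _ ->.
move=> /andP[xz zp] /(IHp z _ zp); apply.
case/orP: xz; rewrite /cay_arc => /(mem_gen (A := S)).
  by rewrite groupMr ?groupV.
by rewrite groupMl // groupV.
Qed.
End CayleyAut.

(** * From a digraph isomorphism to a group automorphism *)

Theorem theorem1p3 (gT : finGroupType) (S : {set gT}) :
  cyclic [set: gT] ->
  S != set0 ->
  digraph_connected (cay_arc S) ->
  arc_transitive (cay_arc S) ->
  forall T : {set gT}, digraph_iso (cay_arc S) (cay_arc T) ->
    exists2 a : {perm gT}, a \in Aut [set: gT] & T = a @: S.
Proof.
move=> cycG /set0Pn[s0 Ss0] connS atS T [f0 f0ST].
pose A := cay_aut S; pose B := cay_aut T.
have trA := @cay_aut_transl _ S; have trB := @cay_aut_transl _ T.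
have boS : block_orbit A 1%G S := arc_transitive_block_orbit atS.
have [stS _ trS] := boS; have stT : stable B T := cay_aut_stable T.
have genS := connected_gen connS.
have [f fST f1] : exists2 f, carries f S T & f 1 = 1.
  exists (f0 * perm (mulIg (f0 1)^-1)); last by rewrite permM permE mulgV.
  move=> u v; rewrite !permM (cay_autP _ _ (trB _)); exact: f0ST.
have conjB a : a \in A -> f^-1 * a * f \in B.
  move=> /cay_autP aS; apply/cay_autP=> u v.
  by rewrite !permM fST aS (carriesV fST).
have f_mem (X Y : {set gT}) x : carries f X Y -> (f x \in Y) = (x \in X).
  by move/(_ 1 x); rewrite f1 invg1 !mulg1.
have defT : T = f @: S := carries_eq f1 fST.
have boT : block_orbit B 1%G T.
  split; rewrite ?sub1G // => x y; rewrite defT.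
  move=> /imsetP[x' Sx' ->] /imsetP[y' Sy' ->].
  have [a [Aa /set1P a1 <-]] := trS x' y' Sx' Sy'.
  exists (f^-1 * a * f); rewrite conjB // !permM permK; split=> //.
  by rewrite -f1 permK a1 f1 set11.
(* The preimage of [K] under [f] is a subgroup of the same order as [K], hence equal to [K] as G is
   cyclic. *)
have carries_stable (K : {group gT}) : stable B K -> carries f K K.
  move=> /stableP stK.
  have fK u v : (f v * (f u)^-1 \in K) = (f (v * u^-1) \in K).
    have Bb : f^-1 * perm (mulIg u^-1) * f \in B by apply: conjB.
    by have := stK _ Bb (f u) (f v); rewrite !permM !permK !permE mulgV f1 invg1 mulg1.
  have fV x : f x \in K -> f x^-1 \in K.
    by move=> Kfx; rewrite -[x^-1]mul1g -fK f1 mul1g groupV.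
  have gK' : group_set [set x | f x \in K].
    apply/group_setP; split=> [|x y]; rewrite !inE ?f1 ?group1 // => Kx Ky.
    by rewrite -[y]invgK -fK groupM ?groupV ?fV.
  have fK'K : carries f (Group gK') K by move=> u v; rewrite fK inE.
  by rewrite -{1}(carries_group cycG f1 fK'K).
have genT : <<T>> = [set: gT].
  have := carries_gen fST; rewrite genS => fG.
  by apply/setP=> y; rewrite -[y](permKV f) (f_mem _ _ _ fG) !inE.
have n1 : coprime #|gT| 1 := coprimen1 _.
(* Generators [u] in [S] and [v] in [T] fix an exponent m with [v = u ^+ m]; the automorphism will
   be the m-th power map. *)
have [u [Su _ o_u]] : exists w, [/\ w \in S, w ^+ 1 \in S & #[w] = #|gT|].
  apply: (block_orbit_generator cycG trA trA boS boS genS genS n1 (y := s0)); by rewrite ?expg1.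
have [v [Tv _ o_v]] : exists w, [/\ w \in T, w ^+ 1 \in T & #[w] = #|gT|].
  apply: (block_orbit_generator cycG trB trB boT boT genT genT n1 (y := f s0));
  by rewrite ?expg1 (f_mem _ _ _ fST).
have gen_u x : x \in <[u]>.
  suff -> : <[u]> = [set: gT] by rewrite inE.
  by apply/eqP; rewrite eqEcard subsetT cardsT -o_u leqnn.
have coprime_exp k w : #[w] = #|gT| -> w = u ^+ k -> coprime #|gT| k.
  move=> o_w Dw; rewrite -o_u -generator_coprime /generator eq_sym eqEcard.
  by rewrite -Dw cycle_subG gen_u -!orderE o_w o_u leqnn.
have /cycleP[m Dv] := gen_u v; have co_m := coprime_exp m v o_v Dv.
have sub_mS s : s \in S -> s ^+ m \in T.
  move=> Ss; pose X := orb B 1%G (s ^+ m).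
  have Xs : s ^+ m \in X := mem_orb _ _ _.
  have boX : block_orbit B 1%G X := orb_block_orbit _ trB (stable1 B).
  have [stX _ _] := boX.
  have genX : <<X>> = [set: gT].
    (* [f] preserves [<<X>>], so the stabiliser of 1 in [A] does too. As [<<X>>] contains [s], a
       power of [s ^+ m], it contains all of [S]. *)
    have fXX := carries_stable <<X>>%G (stable_gen stX).
    apply/eqP; rewrite eqEsubset subsetT -genS gen_subG; apply/subsetP=> t St.
    have [a [Aa /set1P a1 <-]] := trS s t Ss St.
    have Xs' : s \in <<X>>.
      rewrite -(expgK _ (in_setT s) (k := m)) ?cardsT // groupX //.
      exact: mem_gen.
    have c1 : (f^-1 * a * f) 1 = 1 by rewrite !permM -{1}f1 permK a1 f1.
    have := stable_mem (f s) (stable_gen stX) (conjB a Aa) c1.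
    by rewrite !permM permK !(f_mem _ _ _ fXX) Xs'.
  have [w [Sw Xw o_w]] := block_orbit_generator cycG trA trB boS boX genS genX co_m Ss Xs.
  have /cycleP[k Dw] := gen_u w; have co_k := coprime_exp k w o_w Dw.
  (* As [u] and [w = u ^+ k] are both in [S], the k-th power map fixes [S] and, through [f], also
     [T]. So [w ^+ m = v ^+ k] is in [T], and [X] meets [T]. *)
  have kS : powers k S = S.
    by apply: (block_orbit_powers cycG boS co_k Sw); rewrite Dw; apply/imsetP; exists u.
  have kT : powers k T = T.
    by rewrite (carries_eq f1 (carries_powers cycG co_k fST)) kS -defT.
  apply: (subsetP (block_orbit_stable boX stT (sub1G _) _)) Xs.
  apply/set0Pn; exists (w ^+ m); rewrite inE Xw -kT; apply/imsetP; exists v => //.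
  by rewrite Dw Dv -!expgM mulnC.
exists (perm (expg_inj co_m)).
  rewrite inE; apply/andP; split; first by apply/subsetP=> x; rewrite !inE.
  by apply/morphicP=> x y _ _; rewrite !permE (expgMC cycG).
apply/eqP; rewrite eq_sym eqEcard; apply/andP; split.
  by apply/subsetP=> _ /imsetP[s Ss ->]; rewrite permE sub_mS.
by rewrite defT !card_imset //; apply: perm_inj.
Qed.
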